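(* Let $X$ be an infinite-dimensional metrizable locally convex topological vector space which is not normable, and let $\mathcal{F}$ be a free filter on $\mathbb{N}$. (1) If the uniform $\mathcal{F}$-boundedness principle holds for $X$, then $\mathcal{F}$ is a P$^+$-filter. (2) If the stationary uniform $\mathcal{F}$-boundedness principle holds for $X$, then $\mathcal{F}$ is a weak P$^+$-filter.
   Context: $\mathbb{N}=\{0,1,2,\ldots\}$. A filter on $\mathbb{N}$ is a non-empty, upwards closed family $\mathcal{F}\subsetneq P(\mathbb{N})$ closed under finite intersections; it is free if it contains all cofinite subsets of $\mathbb{N}$. A set $A\subseteq\mathbb{N}$ is $\mathcal{F}$-stationary if $\mathbb{N}\setminus A\notin\mathcal{F}$. $(\forall_{\mathcal{F}}\, i\in\mathbb{N})\,\Phi(i)$ means $\{i\in\mathbb{N}:\Phi(i)\}\in\mathcal{F}$. $A\subseteq^* B$ means $A\setminus B$ is finite. $\mathcal{F}$ is a weak P$^+$-filter if for every decreasing sequence $(A_k)_k$ of sets in $\mathcal{F}$ and every $\mathcal{F}$-stationary set $I$ there is an $\mathcal{F}$-stationary set $B\subseteq I$ with $B\subseteq^* A_k$ for every $k$. $\mathcal{F}$ is a P$^+$-filter if for every decreasing sequence $(A_k)_k$ of $\mathcal{F}$-stationary sets there is an $\mathcal{F}$-stationary set $B$ with $B\subseteq^* A_k$ for every $k$. For topological vector spaces $X,Y$, $\mathcal{L}(X,Y)$ is the space of continuous linear maps. A sequence $(y_i)_i$ in $Y$ is $\mathcal{F}$-bounded if for every $0$-neighbourhood $V$ in $Y$ there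 is $t>0$ with $ty_i\in V$ $(\forall_{\mathcal{F}}\, i\in\mathbb{N})$. A sequence $(T_i)_i$ in $\mathcal{L}(X,Y)$ is pointwise $\mathcal{F}$-bounded if $(T_i(x))_i$ is $\mathcal{F}$-bounded for every $x\in X$. It is $\mathcal{F}$-equicontinuous if for every $0$-neighbourhood $V$ in $Y$ there is a $0$-neighbourhood $U$ in $X$ with $T_i[U]\subseteq V$ $(\forall_{\mathcal{F}}\, i\in\mathbb{N})$. It is $\mathcal{F}$-stationary-equicontinuous if for every $\mathcal{F}$-stationary set $I$ and every $0$-neighbourhood $V$ in $Y$ there are a $0$-neighbourhood $U$ in $X$ and an $\mathcal{F}$-stationary set $J\subseteq I$ with $T_i[U]\subseteq V$ for all $i\in J$. The uniform (resp. stationary uniform) $\mathcal{F}$-boundedness principle holds for $X$ if for every locally convex space $Y$, every pointwise $\mathcal{F}$-bounded sequence in $\mathcal{L}(X,Y)$ is $\mathcal{F}$-equicontinuous (resp. $\mathcal{F}$-stationary-equicontinuous). *)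

(* Defs.v *)
From HB Require Import structures.
From mathcomp Require Import all_boot all_order all_algebra.
From mathcomp Require Import complex.
From mathcomp Require Import all_classical all_reals all_analysis.

Set Implicit Arguments.
Unset Strict Implicit.
Unset Printing Implicit Defensive.

Import Order.TTheory GRing.Theory Num.Theory.
Import numFieldNormedType.Exports.

Local Open Scope classical_set_scope.
Local Open Scope ring_scope.

(* The scalar field of the topological vector spaces: real or complex. *)
Variant real_or_complex (R : realType) : numFieldType -> Prop :=
  | RealScalars : real_or_complex R R
  | ComplexScalars : real_or_complex R R[i].

(** Filters on the natural numbers *)

Definition free_filter (F : set_system nat) : Prop := @frechet_filter nat `<=` F.

Definition stationary (F : set_system nat) (A : set nat) : Prop := ~ F (~` A).

Definition almost_subset (A B : set nat) : Prop := finite_set (A `\` B).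

Definition weak_P_plus (F : set_system nat) : Prop :=
  forall A : nat -> set nat,
    (forall k, A k.+1 `<=` A k) -> (forall k, F (A k)) ->
  forall I : set nat, stationary F I ->
  exists B : set nat,
    [/\ stationary F B, B `<=` I & forall k, almost_subset B (A k)].

Definition P_plus (F : set_system nat) : Prop :=
  forall A : nat -> set nat,
    (forall k, A k.+1 `<=` A k) -> (forall k, stationary F (A k)) ->
  exists B : set nat,
    stationary F B /\ forall k, almost_subset B (A k).

(** Topological vector spaces *)

Definition finite_dimensional (K : numFieldType) (X : lmodType K) : Prop :=
  exists (n : nat) (e : 'I_n -> X),
    forall x : X, exists c : 'I_n -> K, x = \sum_(i < n) c i *: e i.

(* As in the library, distances and norms take their values in the field of
   scalars K; over the complex numbers, [0 < e] and [0 <= d x y] say in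
   particular that e and d x y are real. *)
Definition is_distance (K : numFieldType) (T : Type) (d : T -> T -> K) : Prop :=
  [/\ forall x y, 0 <= d x y,
      forall x y, d x y = 0 <-> x = y,
      forall x y, d x y = d y x &
      forall x y z, d x z <= d x y + d y z].

Definition topology_induced_by (K : numFieldType) (T : topologicalType)
    (d : T -> T -> K) : Prop :=
  forall (x : T) (A : set T),
    nbhs x A <-> exists2 e : K, 0 < e & [set y | d x y < e] `<=` A.

Definition metrizable (K : numFieldType) (X : tvsType K) : Prop :=
  exists d : X -> X -> K, is_distance d /\ topology_induced_by d.

Definition is_norm (K : numFieldType) (X : lmodType K) (N : X -> K) : Prop :=
  [/\ forall x, 0 <= N x,
      forall x, N x = 0 <-> x = 0,
      forall (a : K) (x : X), N (a *: x) = `|a| * N x &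
      forall x y, N (x + y) <= N x + N y].

Definition normable (K : numFieldType) (X : tvsType K) : Prop :=
  exists N : X -> K, is_norm N /\ topology_induced_by (fun x y => N (x - y)).

(** Boundedness and equicontinuity along a filter *)

Definition filter_bounded (F : set_system nat) (K : numFieldType)
    (Y : tvsType K) (y : nat -> Y) : Prop :=
  forall V : set Y, nbhs 0 V ->
  exists2 t : K, 0 < t & \forall i \near F, V (t *: y i).

Definition pointwise_filter_bounded (F : set_system nat) (K : numFieldType)
    (X Y : tvsType K) (T : nat -> {linear X -> Y}) : Prop :=
  forall x : X, filter_bounded F (fun i => T i x).

Definition filter_equicontinuous (F : set_system nat) (K : numFieldType)
    (X Y : tvsType K) (T : nat -> {linear X -> Y}) : Prop :=
  forall V : set Y, nbhs 0 V ->
  exists2 U : set X, nbhs 0 U & \forall i \near F, T i @` U `<=` V.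

Definition stationary_equicontinuous (F : set_system nat) (K : numFieldType)
    (X Y : tvsType K) (T : nat -> {linear X -> Y}) : Prop :=
  forall I : set nat, stationary F I ->
  forall V : set Y, nbhs 0 V ->
  exists (U : set X) (J : set nat),
    [/\ nbhs 0 U, stationary F J, J `<=` I &
        forall i, J i -> T i @` U `<=` V].

(* [tvsType K] is the type of locally convex topological vector spaces, not
   necessarily Hausdorff. *)
Definition uniform_boundedness_principle (F : set_system nat)
    (K : numFieldType) (X : tvsType K) : Prop :=
  forall (Y : tvsType K) (T : nat -> {linear X -> Y}),
    (forall i, continuous (T i)) ->
    pointwise_filter_bounded F T -> filter_equicontinuous F T.

Definition stationary_uniform_boundedness_principle (F : set_system nat)
    (K : numFieldType) (X : tvsType K) : Prop :=
  forall (Y : tvsType K) (T : nat -> {linear X -> Y}),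
    (forall i, continuous (T i)) ->
    pointwise_filter_bounded F T -> stationary_equicontinuous F T.

(* Main.v *)
(* Since X is metrizable but not normable, no neighbourhood U_k of a countable
   base at 0 is bounded: some absolutely convex neighbourhood V_k of 0 does not
   absorb U_k.  Given a decreasing sequence A_k whose intersection is
   negligible, let kappa i be the k with i in A_k but not in A_(k+1), and let
   T_i be i.+1^-1 times the i-th coordinate inclusion of X into a space of
   X-valued sequences, seminormed by the supremum of the gauges of the
   V_(kappa i); mapping into this space replaces continuous functionals that
   are unbounded on U_k, so that no Hahn-Banach theorem is needed.  On U_k, T_i
   is unbounded as soon as kappa i >= k, so (T_i) is not equicontinuous along
   the filter; hence it is not pointwise bounded, and a point x of
   unboundedness yields the stationary set B of those i for which T_i x is not
   in the unit ball: for kappa i = k this bounds i.+1 by the gauge of V_k at x,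
   so B meets the complement of each A_k in a finite set. *)
From HB Require Import structures.
Require Import Defs.
From mathcomp Require Import all_boot all_order all_algebra.
From mathcomp Require Import complex.
From mathcomp Require Import all_classical all_reals all_analysis.

Set Implicit Arguments.
Unset Strict Implicit.
Unset Printing Implicit Defensive.

Import Order.TTheory GRing.Theory Num.Theory.
Import numFieldNormedType.Exports.

Local Open Scope classical_set_scope.
Local Open Scope ring_scope.

(** * Infima of nonnegative real or complex scalars *)

(* Completeness in a form that makes sense for the real and for the complex
   numbers, whose nonnegative elements are real. *)
Definition has_glb_nneg (K : numFieldType) : Prop :=
  forall S : set K, S !=set0 -> (forall s, S s -> 0 <= s) ->
  exists m, [/\ 0 <= m, forall s, S s -> m <= s &
                forall e, m < e -> exists2 s, S s & s < e].

Lemma has_glb_nneg_real (R : realType) : has_glb_nneg R.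
Proof.
move=> S S0 Sge0.
have lbS : lbound S 0 by move=> s /Sge0.
exists (inf S); split => [|s Ss|e]; first exact: lb_le_inf.
  by apply: ge_inf => //; exists 0.
exact: inf_lt.
Qed.

(** Nonnegative complex numbers have zero imaginary part, so the infimum of the real parts
    serves. *)
Lemma has_glb_nneg_complex (R : realType) : has_glb_nneg R[i].
Proof.
move=> S [s0 Ss0] Sge0.
have SE s : S s -> s = (complex.Re s)%:C%C /\ 0 <= complex.Re s.
  by move/Sge0; case: s => a b; rewrite lecE /= => /andP[/eqP -> ?].
have [||m [m0 mlb mglb]] := @has_glb_nneg_real R [set complex.Re s | s in S].
- by exists (complex.Re s0), s0.
- by move=> _ [s Ss <-]; have [] := SE s Ss.
exists m%:C%C; split => [|s Ss|[a b]]; first by rewrite lecR.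
  by rewrite (SE s Ss).1 lecR; apply: mlb; exists s.
rewrite ltcE /= => /andP[/eqP -> /mglb[_ [s Ss <-] ltsa]].
by exists s => //; rewrite (SE s Ss).1 ltcR.
Qed.

Lemma real_or_complex_has_glb_nneg (R : realType) (K : numFieldType) :
  real_or_complex R K -> has_glb_nneg K.
Proof. by case; [exact: has_glb_nneg_real|exact: has_glb_nneg_complex]. Qed.

(** The infimum [m] of the [n.+1%:R^-1] is 0: if it were positive, some [n.+1%:R^-1] would lie below
    [2 m], although [m] is at most half of [n.+1%:R^-1], which is again in the family. *)
Lemma has_glb_nneg_archimedean (K : numFieldType) (e : K) :
  has_glb_nneg K -> 0 < e -> exists n, n.+1%:R^-1 < e.
Proof.
move=> hK e_gt0.
have [||m [m0 mlb mglb]] := hK [set n.+1%:R^-1 | n in [set: nat]].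
- by exists 1%:R^-1, 0%N.
- by move=> _ [n _ <-].
suff m_eq0 : m = 0.
  by move: e_gt0; rewrite -m_eq0 => /mglb[_ [n _ <-] ?]; exists n.
apply/eqP; rewrite eq_le m0 andbT; apply: contraT => mN0.
have m_gt0 : 0 < m by rewrite lt_def m0 andbT; apply: contraNneq mN0 => ->.
have [|_ [n _ <-]] := mglb (m *+ 2); first by rewrite mulr2n ltrDl.
have : m <= (n.*2.+1).+1%:R^-1 by apply: mlb; exists n.*2.+1.
rewrite -doubleS -muln2 natrM invfM ler_pdivlMr // -[m *+ 2]mulr_natr => m_le m_gt.
by have := le_lt_trans m_le m_gt; rewrite ltxx.
Qed.

(** * Minkowski gauges and seminorms *)

Section gauge.
Variables (K : numFieldType) (L : lmodType K).
Implicit Types (W : set L) (N : L -> K).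

Definition absolutely_convex W : Prop :=
  W 0 /\ forall a b x y, `|a| + `|b| <= 1 -> W x -> W y -> W (a *: x + b *: y).

Definition absorbing W : Prop := forall x, exists2 t, 0 < t & W (t *: x).

Definition is_seminorm N : Prop :=
  [/\ forall x, 0 <= N x,
      forall (a : K) (x : L), N (a *: x) = `|a| * N x &
      forall x y, N (x + y) <= N x + N y].

Lemma absolutely_convexZ W (a : K) x :
  absolutely_convex W -> `|a| <= 1 -> W x -> W (a *: x).
Proof.
move=> [W0 Wc] a1 Wx; have := Wc a 0 x 0; rewrite scaler0 addr0.
by apply => //; rewrite normr0 addr0.
Qed.

(** [N x] is the greatest lower bound of the [t > 0] with [W (t^-1 *: x)]. It need not be attained,
    hence the large inequality in one direction and the strict one in the other. *)
Lemma gauge_exists W (hK : has_glb_nneg K) (hW : absolutely_convex W)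
    (aW : absorbing W) :
  exists N, [/\ is_seminorm N, forall x, W x -> N x <= 1 &
                forall e x, N x < e -> W (e^-1 *: x)].
Proof.
have glbW x : exists m, [/\ 0 <= m,
    forall t, 0 < t -> W (t^-1 *: x) -> m <= t &
    forall e, m < e -> W (e^-1 *: x)].
  have [||m [m0 mlb mglb]] := hK [set t | 0 < t /\ W (t^-1 *: x)].
  - have [t t0 Wt] := aW x; exists t^-1 => /=.
    by rewrite invr_gt0 invrK.
  - by move=> s [/ltW].
  exists m; split => // [t t0 Wt|e /mglb[t [t0 Wt] te]]; first exact: mlb.
  have e0 : 0 < e by exact: lt_trans te.
  rewrite -[x](scalerKV (lt0r_neq0 t0)) scalerA.
  apply: absolutely_convexZ => //.
  by rewrite ger0_norm ?mulr_ge0 ?invr_ge0 ?ltW// ltr_pdivrMl// mulr1.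
pose N x := projT1 (cid (glbW x)).
have N0 x : 0 <= N x by rewrite /N; case: cid => /= m [].
have Nle x t : 0 < t -> W (t^-1 *: x) -> N x <= t.
  by rewrite /N; case: cid => /= m [_ + _]; apply.
have NW x e : N x < e -> W (e^-1 *: x).
  by rewrite /N; case: cid => /= m [_ _]; apply.
(* This inequality suffices for homogeneity: the reverse one is its instance for [a^-1] and
   [a *: x]. *)
have NZ_le a x : a != 0 -> N (a *: x) <= `|a| * N x.
  move=> a0; have na0 : 0 < `|a| by rewrite normr_gt0.
  apply/ler_addgt0Pr => e e0.
  have lt_s : N x < N x + e / `|a| by rewrite ltrDl divr_gt0.
  rewrite -[e](divfK (lt0r_neq0 na0)) [e / _ * _]mulrC -mulrDr.
  set s := N x + _ in lt_s *; have s0 : 0 < s by exact: le_lt_trans lt_s.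
  apply: Nle; first by rewrite mulr_gt0.
  rewrite invfM scalerA mulrAC -scalerA.
  apply: absolutely_convexZ (NW _ _ lt_s) => //.
  by rewrite normrM normfV normr_id mulVf ?lt0r_neq0.
exists N; split; last 2 first.
- by move=> x Wx; apply: Nle; rewrite ?ltr01 ?invr1 ?scale1r.
- by move=> e x; exact: NW.
split => // [a x|x y].
  have [->|a0] := eqVneq a 0.
    rewrite scale0r normr0 mul0r; apply/eqP; rewrite eq_le N0 andbT.
    apply/ler_addgt0Pr => e e0; rewrite add0r; apply: Nle => //.
    by rewrite scaler0; case: hW.
  apply/eqP; rewrite eq_le NZ_le //=.
  have na0 : 0 < `|a| by rewrite normr_gt0.
  rewrite -ler_pdivlMl// -[in leLHS](scalerK a0 x) -normfV.
  by apply: NZ_le; rewrite invr_eq0.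
apply/ler_addgt0Pr => e e0.
have e20 : 0 < e / 2 by rewrite divr_gt0.
have lt_s : N x < N x + e / 2 by rewrite ltrDl.
have lt_t : N y < N y + e / 2 by rewrite ltrDl.
rewrite [e]splitr addrACA.
set s := N x + _ in lt_s *; set t := N y + _ in lt_t *.
have s0 : 0 < s by exact: le_lt_trans lt_s.
have t0 : 0 < t by exact: le_lt_trans lt_t.
have st0 : 0 < s + t by rewrite addr_gt0.
apply: Nle => //.
(* Subadditivity: this writes the rescaled sum as a convex combination of [s^-1 *: x] and
   [t^-1 *: y], both in [W] because [s] and [t] exceed the gauges of [x] and [y]. *)
have -> : (s + t)^-1 *: (x + y) =
    (s / (s + t)) *: (s^-1 *: x) + (t / (s + t)) *: (t^-1 *: y).
  by rewrite !scalerA ![_ / (s + t) * _]mulrAC !divff ?lt0r_neq0// !mul1r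
    scalerDr.
apply: (hW.2 _ _ _ _ _ (NW _ _ lt_s) (NW _ _ lt_t)).
rewrite (ger0_norm (divr_ge0 (ltW s0) (ltW st0))) (ger0_norm (divr_ge0 (ltW t0) (ltW st0))).
by rewrite -mulrDl divff ?lt0r_neq0.
Qed.

Section seminorm.
Variable N : L -> K.
Hypothesis hN : is_seminorm N.

Lemma seminorm_ge0 x : 0 <= N x. Proof. by case: hN. Qed.

Lemma seminormZ a x : N (a *: x) = `|a| * N x. Proof. by case: hN. Qed.

Lemma seminormD x y : N (x + y) <= N x + N y. Proof. by case: hN. Qed.

Lemma seminorm0 : N 0 = 0.
Proof. by have := seminormZ 0 0; rewrite scale0r normr0 mul0r. Qed.

Lemma seminormN x : N (- x) = N x.
Proof. by rewrite -scaleN1r seminormZ normrN1 mul1r. Qed.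

Lemma seminormB x y : N (x - y) = N (y - x).
Proof. by rewrite -seminormN opprB. Qed.

Lemma seminorm_dist x y z : N (x - z) <= N (x - y) + N (y - z).
Proof. by rewrite -[x - z](subrKA y) seminormD. Qed.

End seminorm.

End gauge.

(** * The locally convex space defined by one seminorm *)

(** A copy of [L]; the argument [is_seminorm N] ties the topology given by [N] to the type. *)
Definition seminormed_space (K : numFieldType) (L : lmodType K) (N : L -> K)
  (_ : is_seminorm N) : Type := L.

Section seminormed_space.
Variables (K : numFieldType) (L : lmodType K) (N : L -> K).
Hypothesis hN : is_seminorm N.

Local Notation E := (seminormed_space hN).

HB.instance Definition _ := GRing.Lmodule.on E.

Let nbhs_seminorm (x : E) : set_system E :=
  [set A | exists2 e : K, 0 < e & [set y | N (x - y) < e] `<=` A].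

HB.instance Definition _ := hasNbhs.Build E nbhs_seminorm.

Lemma nbhs_seminormP (x : E) (A : set E) :
  nbhs x A <-> exists2 e : K, 0 < e & [set y | N (x - y) < e] `<=` A.
Proof. by []. Qed.

Let nbhs_seminorm_filter (x : E) : ProperFilter (nbhs x).
Proof.
apply: Build_ProperFilter_ex => [A [e e0 eA]|].
  by exists x; apply: eA; rewrite /= subrr seminorm0.
split=> [|A B [d d0 dA] [e e0 eB]|A B AB [e e0 eA]].
- by exists 1.
- have de : d >=< e by rewrite real_comparable ?gtr0_real.
  exists (Num.min d e); first by rewrite comparable_lt_min ?d0.
  move=> y /=; rewrite comparable_lt_min// => /andP[xyd xye].
  by split; [exact: dA|exact: eB].
- by exists e => // y /eA /AB.
Qed.

Let nbhs_seminorm_singleton (x : E) (A : set E) : nbhs x A -> A x.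
Proof. by move=> [e e0]; apply; rewrite /= subrr seminorm0. Qed.

Let open_seminorm_ball (x : E) (e : K) (y : E) :
  N (x - y) < e -> nbhs y [set z : E | N (x - z) < e].
Proof.
move=> xye; exists (e - N (x - y)); first by rewrite subr_gt0.
move=> z /=; rewrite ltrBrDl => /(le_lt_trans _); apply.
exact: (seminorm_dist hN).
Qed.

Let nbhs_seminorm_nbhs (x : E) (A : set E) :
  nbhs x A -> nbhs x (nbhs^~ A : set E).
Proof.
move=> [e e0 eA]; exists e => // y /open_seminorm_ball[d d0 dA].
by exists d => // z /dA /eA.
Qed.

HB.instance Definition _ := Nbhs_isNbhsTopological.Build E
  nbhs_seminorm_filter nbhs_seminorm_singleton nbhs_seminorm_nbhs.

Let seminorm_add_continuous : continuous (fun z : E * E => z.1 + z.2).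
Proof.
move=> [x y] A [e e0 eA]; have e20 : 0 < e / 2 by rewrite divr_gt0.
exists ([set z | N (x - z) < e / 2], [set z | N (y - z) < e / 2]).
  by split; exists (e / 2).
move=> [x' y'] [/= xx' yy']; apply: eA => /=.
by rewrite opprD addrACA (le_lt_trans (seminormD hN _ _))// [e]splitr ltrD.
Qed.

Let seminorm_scale_continuous : continuous (fun z : K^o * E => z.1 *: z.2).
Proof.
move=> [k x] A [e e0 eA]; have e20 : 0 < e / 2 by rewrite divr_gt0.
have Nx0 : 0 <= N x := seminorm_ge0 hN x.
(* [k *: x - l *: y] is split as [(k - l) *: x + l *: (x - y)]. The radius [r] makes the first term
   less than [e / 2], the [+ 1] covering [N x = 0]; [s] does it for the second, since [l] has
   modulus at most [|k| + r]. *)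
pose r := e / 2 / (N x + 1); pose s := e / 2 / (`|k| + r).
have Nx1 : 0 < N x + 1 by rewrite ltr_wpDl.
have r0 : 0 < r by rewrite divr_gt0.
have kr0 : 0 < `|k| + r by rewrite ltr_wpDl.
have s0 : 0 < s by rewrite divr_gt0.
exists (ball (k : K^o) r, [set y | N (x - y) < s]).
  by split; [exact: nbhsx_ballx|exists s].
move=> [l y] [/= kl xy]; apply: eA => /=.
have {}kl : `|k - l| < r by move: kl; rewrite -ball_normE.
have -> : k *: (x : L) - l *: y = (k - l) *: x + l *: (x - y).
  by rewrite scalerBl scalerBr addrA subrK.
rewrite (le_lt_trans (seminormD hN _ _))// !(seminormZ hN) [e]splitr.
apply: ltr_leD.
  rewrite (le_lt_trans (ler_wpM2r Nx0 (ltW kl)))// /r mulrAC ltr_pdivrMr//.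
  by rewrite ltr_pM2l// ltrDl.
rewrite -[leRHS](divfK (lt0r_neq0 kr0)) -/s [s * _]mulrC.
apply: ler_pM; rewrite ?(seminorm_ge0 hN)//; last exact: ltW.
apply: ltW; by rewrite -[l](subKr k) (le_lt_trans (ler_normB _ _))// ltrD2l.
Qed.

Let seminorm_locally_convex :
  exists2 B : set_system E, (forall b, b \in B -> convex_set b) & basis B.
Proof.
exists [set B | exists x e, B = [set y : E | N (x - y) < e]].
  move=> B /[!inE] -[x [e ->]]; apply/convex_setW => y z.
  rewrite !inE /= => xy xz l l0 l1; rewrite inE /=.
  have -> : x - conv l (y : convex_lmodType E) z =
      l%:num *: (x - y) + (1 - l%:num) *: (x - z).
    by rewrite !scalerBr addrACA -scalerDl [_ + (1 - _)]addrC subrK scale1r -opprD.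
  rewrite (le_lt_trans (seminormD hN _ _))// !(seminormZ hN).
  have l1' : 0 < 1 - l%:num by rewrite subr_gt0.
  rewrite (gtr0_norm l0) (gtr0_norm l1').
  have -> : e = l%:num * e + (1 - l%:num) * e.
    by rewrite -mulrDl [_ + (1 - _)]addrC subrK mul1r.
  by rewrite ltrD// ltr_pM2l.
split.
  move=> _ [x [e ->]]; rewrite openE => y; exact: open_seminorm_ball.
move=> x A [e e0 eA]; exists [set y : E | N (x - y) < e] => //.
by split; [exists x, e|rewrite /= subrr seminorm0].
Qed.

(* Despite its name, this factory provides the uniform structure only. *)
HB.instance Definition _ := PreTopologicalLmod_isTvs.Build K E
  seminorm_add_continuous seminorm_scale_continuous seminorm_locally_convex.
HB.instance Definition _ := PreTopologicalNmodule_isTopologicalNmodule.Build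
  E seminorm_add_continuous.
HB.instance Definition _ := TopologicalNmodule_isTopologicalLmodule.Build
  K E seminorm_scale_continuous.
HB.instance Definition _ := Uniform_isTvs.Build K E seminorm_locally_convex.

End seminormed_space.


(** * Neighbourhoods of 0 in a locally convex space, and normability *)

Section locally_convex.
Variables (K : numFieldType) (X : tvsType K).
Implicit Types (A U V : set X) (x : X).

Lemma nbhs0_absorbing A : nbhs 0 A -> absorbing A.
Proof.
move=> A0 x; have := @scale_continuous K X (0, x) A.
rewrite /= scale0r => /(_ A0) [[P Q] [/= P0 Qx] PQ].
move: P0 => /nbhs_ballP[r /= r0 rP]; have r20 : 0 < r / 2 by rewrite divr_gt0.
exists (r / 2) => //; apply: (PQ (r / 2, x)); split; last exact: nbhs_singleton.
apply: rP; rewrite -ball_normE /= sub0r normrN gtr0_norm//.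
by rewrite ltr_pdivrMr// ltr_pMr// ltr1n.
Qed.

Lemma nbhs_translate x A : nbhs x A <-> nbhs 0 [set y | A (x + y)].
Proof.
split=> [xA|A0].
  have := nbhsB (- x) xA; rewrite addNr; apply: filterS => _ [y Ay <-] /=.
  by rewrite addNKr.
by apply: filterS (nbhsT x A0) => _ [y Ay <-].
Qed.

Lemma nbhs0_scale A (r : K) : r != 0 -> nbhs 0 A -> nbhs 0 [set x | A (r *: x)].
Proof.
move=> r0 A0; have := @nbhs0Z K X A r^-1; rewrite invr_eq0 => /(_ r0 A0).
by apply: filterS => _ [y Ay <-] /=; rewrite scalerA divff// scale1r.
Qed.

(** The balanced core of a convex neighbourhood [C] inside [A] works: it is a neighbourhood of 0 by
    continuity of scaling at [(0, 0)], and it inherits convexity from [C]. *)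
Lemma nbhs0_absolutely_convex A : nbhs 0 A ->
  exists V, [/\ absolutely_convex V, nbhs 0 V & V `<=` A].
Proof.
move=> A0; have [B Bconvex [Bopen Bbasis]] := @locally_convex K X.
have [C [BC C0] CA] := Bbasis 0 A A0.
have Cconvex : convex_set C by apply: Bconvex; rewrite inE.
have nC : nbhs 0 C by apply: open_nbhs_nbhs; split => //; exact: Bopen.
exists [set x | forall a : K, `|a| <= 1 -> C (a *: x)]; split; last 2 first.
- have := @scale_continuous K X (0, 0) C.
  rewrite /= scale0r => /(_ nC) [[P Q] [/= P0 Q0] PQ].
  move: P0 => /nbhs_ballP[r /= r0 rP].
  have r20 : 0 < r / 2 by rewrite divr_gt0.
  have r2N0 := lt0r_neq0 r20.
  apply: filterS (@nbhs0_scale Q (r / 2)^-1 _ Q0); last by rewrite invr_eq0.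
  move=> x /= Qx a a1; rewrite -[x](scalerKV r2N0) scalerA.
  apply: (PQ (a * (r / 2), _)); split => //; apply: rP.
  rewrite -ball_normE /= sub0r normrN normrM (gtr0_norm r20).
  rewrite (le_lt_trans (ler_wpM2r (ltW r20) a1))// mul1r.
  by rewrite ltr_pdivrMr// ltr_pMr// ltr1n.
- by move=> x /(_ 1); rewrite normr1 scale1r => /(_ (lexx _)) /CA.
split=> [a _|a b x y ab Vx Vy c c1]; first by rewrite scaler0.
have a1 : `|a| <= 1 by rewrite (le_trans _ ab)// lerDl.
(* [c *: (a *: x + b *: y)] becomes a convex combination with weights [|a|] and [t = 1 - |a|]. If a
   weight vanishes, so does the corresponding term, and division by 0 yields 0. *)
pose s := Itv01 (normr_ge0 a) a1; pose t := 1 - `|a|.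
have bt : `|b| <= t by rewrite lerBrDl.
have t0 : 0 <= t by rewrite subr_ge0.
have aE : `|a| * (c * a / `|a|) = c * a.
  have [->|aN0] := eqVneq a 0; first by rewrite normr0 !(mulr0, mul0r).
  by rewrite mulrC divfK// normr_eq0.
have bE : t * (c * b / t) = c * b.
  have [t_eq0|tN0] := eqVneq t 0; last by rewrite mulrC divfK.
  have -> : b = 0 by apply/eqP; rewrite -normr_le0 -t_eq0.
  by rewrite !mulr0 mul0r mulr0.
have Cx : C ((c * a / `|a|) *: x).
  apply: Vx; rewrite !normrM normfV normr_id.
  have [->|aN0] := eqVneq a 0; first by rewrite normr0 !(mulr0, mul0r).
  by rewrite mulfK// normr_eq0.
have Cy : C ((c * b / t) *: y).
  apply: Vy; rewrite !normrM normfV (ger0_norm t0).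
  have [->|tN0] := eqVneq t 0; first by rewrite invr0 mulr0.
  have t_gt0 : 0 < t by rewrite lt_def tN0.
  by rewrite ler_pdivrMr// ler_pM.
have := Cconvex _ _ s (mem_set Cx) (mem_set Cy); rewrite inE.
suff -> : conv s ((c * a / `|a|) *: x : convex_lmodType X) ((c * b / t) *: y) =
  c *: (a *: x + b *: y) by [].
have -> : conv s ((c * a / `|a|) *: x : convex_lmodType X) ((c * b / t) *: y) =
  `|a| *: ((c * a / `|a|) *: x) + t *: ((c * b / t) *: y) by [].
by rewrite !scalerA aE bE scalerDr !scalerA.
Qed.

(** Kolmogorov's criterion: the gauge of an absolutely convex neighbourhood inside the bounded set
    [U] is a norm inducing the topology; separation gives definiteness. *)
Lemma locally_bounded_normable U : has_glb_nneg K ->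
  (forall x, x != 0 -> exists2 A, nbhs 0 A & ~ A x) -> nbhs 0 U ->
  (forall V, absolutely_convex V -> nbhs 0 V ->
    exists2 t : K, 0 < t & forall x, U x -> V (t *: x)) ->
  normable X.
Proof.
move=> hK hausX U0 bU.
have [W [Wc W0 WU]] := nbhs0_absolutely_convex U0.
have [N [Nsemi WN NW]] := gauge_exists hK Wc (nbhs0_absorbing W0).
have ballN V : absolutely_convex V -> nbhs 0 V ->
    exists2 t : K, 0 < t & forall x, N x < t -> V x.
  move=> Vc V0; have [t t0 tV] := bU V Vc V0; exists t => // x /NW Wx.
  by rewrite -[x](scalerKV (lt0r_neq0 t0)); exact/tV/WU.
exists N; split.
  split=> [x|x|a x|x y]; [exact: (seminorm_ge0 Nsemi)| |
    exact: (seminormZ Nsemi)|exact: (seminormD Nsemi)].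
  split=> [Nx0|->]; last exact: (seminorm0 Nsemi).
  apply/eqP; apply: contraPT isT => /hausX[A A0 /(_ _)].
  have [V [Vc V0 VA]] := nbhs0_absolutely_convex A0.
  have [t t0 tV] := ballN V Vc V0.
  by move=> nAx _; apply: nAx; apply/VA/tV; rewrite Nx0.
move=> x A; split=> [/nbhs_translate A0|[e e0 eA]].
  have [V [Vc V0 VA]] := nbhs0_absolutely_convex A0.
  have [t t0 tV] := ballN V Vc V0.
  exists t => // y /=; rewrite (seminormB Nsemi) => /tV/VA /=.
  by rewrite addrC subrK.
apply/nbhs_translate.
have e20 : 0 < e / 2 by rewrite divr_gt0.
apply: filterS (@nbhs0_scale W (e / 2)^-1 _ W0); last first.
  by rewrite invr_eq0 lt0r_neq0.
move=> y /= /WN; rewrite (seminormZ Nsemi) gtr0_norm ?invr_gt0//.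
rewrite ler_pdivrMl// mulr1 => Ny; apply: eA => /=.
rewrite opprD addNKr (seminormN Nsemi) (le_lt_trans Ny)//.
by rewrite ltr_pdivrMr// ltr_pMr// ltr1n.
Qed.

Lemma metrizable_hausdorff0 : metrizable X ->
  forall x, x != 0 -> exists2 A, nbhs 0 A & ~ A x.
Proof.
move=> [d [[d0 d_eq0 _ _] dX]] x xN0; have dx0 : 0 < d 0 x.
  rewrite lt_def d0 andbT; apply: contra_neq xN0 => /d_eq0 -> //.
exists [set y | d 0 y < d 0 x]; last by rewrite /= ltxx.
by apply/dX; exists (d 0 x).
Qed.

Lemma metrizable_countable_base0 : has_glb_nneg K -> metrizable X ->
  exists U : nat -> set X, [/\ forall k, nbhs 0 (U k),
    forall j k, (j <= k)%N -> U k `<=` U j &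
    forall A, nbhs 0 A -> exists k, U k `<=` A].
Proof.
move=> hK [d [_ dX]]; exists (fun k => [set x | d 0 x < k.+1%:R^-1]).
split=> [k|j k jk x /= xk|A /dX[e e0 eA]].
- by apply/dX; exists k.+1%:R^-1; rewrite ?invr_gt0.
- by rewrite (lt_le_trans xk)// lef_pV2 ?posrE// ler_nat ltnS.
have [k ke] := has_glb_nneg_archimedean hK e0; exists k => x /= xk.
by apply: eA; exact: lt_trans ke.
Qed.

End locally_convex.

(** * The linear span of an absolutely convex set *)

Section absorbed_space.
Variables (K : numFieldType) (L : lmodType K) (W : set L).
Hypothesis hW : absolutely_convex W.

(** The subspace on which [W] is absorbing, so that its gauge is finite there. Absolute convexity is
    an argument because closure under addition depends on it. *)
Definition absorbed of absolutely_convex W : {pred L} :=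
  fun x => `[< exists2 t : K, 0 < t & W (t *: x) >].

Let absorbed_submod_closed : submod_closed (absorbed hW).
Proof.
split; first by apply/asboolP; exists 1; rewrite ?ltr01 // scaler0; case: hW.
move=> a x y /asboolP[s s0 Wx] /asboolP[t t0 Wy]; apply/asboolP.
have sN0 := lt0r_neq0 s0; have tN0 := lt0r_neq0 t0.
(* Chosen so that the two coefficients below have moduli summing to 1. *)
pose r := `|a| / s + t^-1.
have r0 : 0 < r by rewrite ltr_wpDl ?invr_gt0// divr_ge0 ?normr_ge0 ?ltW.
exists r^-1; first by rewrite invr_gt0.
have -> : r^-1 *: (a *: x + y) =
    (r^-1 * a / s) *: (s *: x) + (r^-1 / t) *: (t *: y).
  by rewrite !scalerA !divfK// scalerDr scalerA.
apply: hW.2 => //.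
rewrite !normrM !normfV (gtr0_norm r0) (gtr0_norm s0) (gtr0_norm t0).
by rewrite -mulrA -mulrDr -/r mulVf ?lt0r_neq0.
Qed.

HB.instance Definition _ :=
  GRing.isSubmodClosed.Build K L (absorbed hW) absorbed_submod_closed.

Record absorbed_space : Type := AbsorbedSpace {
  absorbed_val : L;
  absorbed_valP : absorbed_val \in absorbed hW }.

HB.instance Definition _ := [isSub for absorbed_val].
HB.instance Definition _ := [Choice of absorbed_space by <:].
HB.instance Definition _ := [SubChoice_isSubLmodule of absorbed_space by <:].

End absorbed_space.

(** * Sequences with the supremum of gauges *)

Section locally_convex_sum.
Variables (K : numFieldType) (X : tvsType K) (V : nat -> set X).
Hypothesis hK : has_glb_nneg K.
Hypothesis Vconvex : forall i, absolutely_convex (V i).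
Hypothesis V0 : forall i, nbhs 0 (V i).

Let box : set (nat -> X) := [set y | forall i, V i (y i)].

Let box_convex : absolutely_convex box.
Proof.
split=> [i|a b x y ab Vx Vy i]; first by case: (Vconvex i).
by apply: (Vconvex i).2; [exact: ab|exact: Vx|exact: Vy].
Qed.

Let L := absorbed_space box_convex.

Let single_fun i x : nat -> X := fun j => if j == i then x else 0.

Let box_single_fun i x : box (single_fun i x) <-> V i x.
Proof.
split=> [/(_ i)|Vx j]; rewrite /single_fun ?eqxx//.
by case: eqP => [->//|_]; case: (Vconvex j).
Qed.

Let single_fun_absorbed i x : single_fun i x \in absorbed box_convex.
Proof.
apply/asboolP; have [t t0 Vt] := nbhs0_absorbing (V0 i) x; exists t => //.
suff -> : t *: single_fun i x = single_fun i (t *: x) by exact/box_single_fun.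
apply/funext => j; rewrite /single_fun /= scalrfctE.
by case: eqP; rewrite ?scaler0.
Qed.

Let single i x : L := AbsorbedSpace (single_fun_absorbed i x).

Let single_linear i : linear (single i).
Proof.
move=> a x y; apply/val_inj/funext => j.
rewrite linearP /= /single_fun fctE scalrfctE.
by case: eqP; rewrite // scaler0 addr0.
Qed.

(** [Y] is the span of the product of the [V i], with the gauge of that product as seminorm, and [W]
    is the product itself, hence bounded. [T i] puts [x] in coordinate [i] and 0 elsewhere, so
    membership in [W] only tests [V i]. *)
Lemma sup_seminorm_space : exists (Y : tvsType K) (T : nat -> {linear X -> Y})
    (W : set Y), [/\ forall i, continuous (T i), nbhs 0 W,
    forall G, nbhs 0 G -> exists2 t : K, 0 < t & forall y, W y -> G (t *: y) &
    forall i x, W (T i x) <-> V i x].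
Proof.
pose W : set L := [set y | box (val y)].
have Wconvex : absolutely_convex W.
  split=> [|a b x y ab Wx Wy]; first exact: box_convex.1.
  by rewrite -[W _]/(box (val _)) linearP linearZ; exact: box_convex.2.
have Wabsorbing : absorbing W.
  by move=> y; have /asboolP[t t0 Wt] := absorbed_valP y; exists t.
have [N [Nsemi WN NW]] := gauge_exists hK Wconvex Wabsorbing.
pose Y : tvsType K := seminormed_space Nsemi.
have Tlin i : linear (single i : X -> Y) := @single_linear i.
pose T i : {linear X -> Y} :=
  HB.pack (single i : X -> Y) (GRing.isLinear.Build K X Y _ _ (Tlin i)).
exists Y, T, W; split=> [i x A|||i x].
- move=> /nbhs_seminormP[e e0 eA]; apply/nbhs_translate.
  have e20 : 0 < e / 2 by rewrite divr_gt0.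
  apply: filterS (@nbhs0_scale _ _ (V i) (e / 2)^-1 _ (V0 i)); last first.
    by rewrite invr_eq0 lt0r_neq0.
  move=> y Vy; apply: eA; suff: N (T i x - T i (x + y)) < e by [].
  rewrite linearD opprD addNKr.
  have /WN : W (T i ((e / 2)^-1 *: y)) by exact/box_single_fun.
  rewrite linearZ (seminormZ Nsemi) gtr0_norm ?invr_gt0// ler_pdivrMl//.
  rewrite mulr1 (seminormN Nsemi) => /le_lt_trans; apply.
  by rewrite ltr_pdivrMr// ltr_pMr// ltr1n.
- apply/nbhs_seminormP; exists 1 => // y /=.
  by rewrite sub0r (seminormN Nsemi) => /NW; rewrite invr1 scale1r.
- move=> G /nbhs_seminormP[e e0 eG]; exists (e / 2); first by rewrite divr_gt0.
  have e20 : 0 < e / 2 by rewrite divr_gt0.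
  move=> y /WN Ny; apply: eG => /=.
  rewrite sub0r (seminormN Nsemi) (seminormZ Nsemi) gtr0_norm//.
  rewrite (le_lt_trans (ler_wpM2l (ltW e20) Ny))// mulr1.
  by rewrite ltr_pdivrMr// ltr_pMr// ltr1n.
- exact: box_single_fun.
Qed.

End locally_convex_sum.

(** * Construction of the operators and the two implications *)

(** The filter enters only after [T] is built, so both principles use the same operators; [D] is the
    set of indices on which [kappa] is meaningful. *)
Lemma ladder_operators (K : numFieldType) (X : tvsType K) (D : set nat)
    (kappa : nat -> nat) :
  has_glb_nneg K -> metrizable X -> ~ normable X ->
  exists (Y : tvsType K) (T : nat -> {linear X -> Y}),
  [/\ forall i, continuous (T i),
      forall F, Filter F -> ~ pointwise_filter_bounded F T ->
        exists B, [/\ stationary F B, B `<=` D &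
          forall m, finite_set [set i | B i /\ (kappa i < m)%N]] &
      exists2 W : set Y, nbhs 0 W & forall U, nbhs 0 U ->
        exists m, forall i, D i -> T i @` U `<=` W -> (kappa i < m)%N].
Proof.
move=> hK hmetr hnorm.
have [U [U0 Umono Ubase]] := metrizable_countable_base0 hK hmetr.
(* If [U k] had no such [V], it would be a bounded neighbourhood of 0 and [X] would be normable. *)
have /choice[V hV] k : exists V, [/\ absolutely_convex V, nbhs 0 V &
    forall t : K, 0 < t -> exists2 x, U k x & ~ V (t *: x)].
  apply: contrapT => noV; apply: hnorm.
  apply: (locally_bounded_normable hK (metrizable_hausdorff0 hmetr) (U0 k)).
  move=> V Vc V0; apply: contrapT => nt; apply: noV; exists V; split=> // t t0.
  apply: contrapT => nx; apply: nt; exists t => // x Ux.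
  by apply: contrapT => nV; apply: nx; exists x.
(* The factor [i.+1%:R^-1] is built into the neighbourhood. Outside [D] it is the whole space, so
   [T i] maps into [W] there, which forces [B] into [D]. *)
pose V' i : set X := [set x | D i -> V (kappa i) (i.+1%:R^-1 *: x)].
have V'convex i : absolutely_convex (V' i).
  have [Vc _ _] := hV (kappa i).
  split=> [_|a b x y ab Vx Vy Di]; first by rewrite scaler0; case: Vc.
  rewrite scalerDr !(scalerA i.+1%:R^-1) ![i.+1%:R^-1 * _]mulrC -!scalerA.
  by apply: Vc.2 => //; [exact: Vx|exact: Vy].
have V'0 i : nbhs 0 (V' i).
  have [_ V0 _] := hV (kappa i).
  apply: filterS (@nbhs0_scale _ _ _ i.+1%:R^-1 _ V0); first by move=> x ? _.
  by rewrite invr_eq0 pnatr_eq0.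
have [Y [T [W [Tcont W0 Wbounded WT]]]] := sup_seminorm_space hK V'convex V'0.
exists Y, T; split=> // [F FF|].
  move=> /existsNP[x] /existsNP[G] /not_implyP[G0 nG].
  have [t t0 tG] := Wbounded G G0.
  (* As [t *: W] lies in [G], every such [i] has [T i x] outside [W]. *)
  exists [set i | ~ G (t *: T i x)]; split.
  - move=> FG; apply: nG; exists t => //.
    by apply: filterS FG => i /contrapT.
  - move=> i /= nGi; apply: contrapT => nDi; apply: nGi.
    by apply/tG/WT => /nDi.
  move=> m; have -> : [set i | ~ G (t *: T i x) /\ (kappa i < m)%N] =
      \bigcup_(j in `I_m) [set i | ~ G (t *: T i x) /\ kappa i = j].
    apply/seteqP; split=> [i [? ?]|i [j /= jm [? ->]]//].
    by exists (kappa i).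
  apply: bigcup_finite; first exact: finite_II.
  (* On the level [kappa i = j], [V j] contains [s *: x], hence [i.+1%:R^-1 *: x] once [i >= n];
     then [T i x] is in [W]. *)
  move=> j _; have [Vc V0 _] := hV j.
  have [s s0 Vs] := nbhs0_absorbing V0 x.
  have [n ns] := has_glb_nneg_archimedean hK s0.
  apply: sub_finite_set (finite_II n) => i /= [nGi ij]; rewrite ltnNge.
  apply/negP => ni; apply: nGi; apply/tG/WT => _; rewrite ij.
  have -> : i.+1%:R^-1 *: x = (i.+1%:R^-1 / s) *: (s *: x).
    by rewrite scalerA divfK ?lt0r_neq0.
  apply: absolutely_convexZ => //.
  rewrite gtr0_norm ?divr_gt0// ler_pdivrMr// mul1r.
  by rewrite (le_trans _ (ltW ns))// lef_pV2 ?posrE// ler_nat ltnS.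
exists W => // A /Ubase[m UA]; exists m => i Di TA; rewrite ltnNge.
(* [V (kappa i)] does not absorb [U (kappa i)]; using this for the scalar [i.+1%:R^-1] gives a point
   of [U m] that [T i] sends outside [W]. *)
apply/negP => mi; have [_ _ /(_ i.+1%:R^-1)] := hV (kappa i).
rewrite invr_gt0 ltr0n => /(_ isT)[x Ux]; apply.
by apply: (WT i x).1 => //; apply: TA; exists x => //; apply/UA/(Umono _ _ mi).
Qed.

(** [kappa i] is the predecessor of the least [k] with [i] outside [A k]; that [k] is positive
    because [D] lies in [A 0]. *)
Lemma level_function (A : nat -> set nat) (D : set nat) :
  (forall k, A k.+1 `<=` A k) -> D `<=` A 0%N ->
  (forall i, D i -> ~ (\bigcap_k A k) i) ->
  exists kappa : nat -> nat, forall i, D i ->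
    forall m, A m i <-> (m <= kappa i)%N.
Proof.
move=> Adecr DA DN.
have Amono i j k : (j <= k)%N -> A k i -> A j i.
  by move=> /subnK <-; elim: (k - j)%N => // n IH /Adecr.
suff /choice[kappa hkappa] : forall i, exists k, D i ->
    forall m, A m i <-> (m <= k)%N by exists kappa.
move=> i; have [Di|] := pselect (D i); last by exists 0%N.
have exN : exists k, `[< ~ A k i >].
  apply: contrapT => noN; apply: (DN i Di) => k _; apply: contrapT => nAk.
  by apply: noN; exists k; apply/asboolP.
case: (ex_minnP exN) => -[|k] /asboolP nAk kmin.
  by case: nAk; exact: DA.
exists k => _ m; split=> [Am|mk].
  by rewrite leqNgt; apply/negP => km; apply: nAk; exact: Amono Am.
apply: contrapT => nAm; have := kmin m (asboolT nAm).
by rewrite ltnNge mk.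
Qed.

Theorem lemma4p1 (R : realType) (K : numFieldType) (hK : real_or_complex R K)
    (X : tvsType K) (F : set_system nat)
    (hdim : ~ finite_dimensional X) (hmetr : metrizable X)
    (hnorm : ~ normable X) (hF : ProperFilter F) (hfree : free_filter F) :
  (uniform_boundedness_principle F X -> P_plus F) /\
  (stationary_uniform_boundedness_principle F X -> weak_P_plus F).
Proof.
have glbK := real_or_complex_has_glb_nneg hK.
split=> [ubp A Adecr Astat|subp A Adecr AF I Istat];
    pose P := \bigcap_k A k.
(* A stationary intersection is itself the required set; otherwise its complement is in [F] and can
   be discarded. *)
- have [Pstat|/contrapT FNP] := pselect (stationary F P).
    exists P; split=> // k.
    by apply: sub_finite_set (finite_set0 _) => i [Pi []]; exact: Pi.
  have DN i : (A 0%N `\` P) i -> ~ P i by case.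
  have [kappa hkappa] := level_function Adecr (@subDsetl _ _ _) DN.
  have [Y [T [Tcont Tbound [W W0 TW]]]] :=
    ladder_operators (A 0%N `\` P) kappa glbK hmetr hnorm.
  have [|B [Bstat BD Bfin]] := Tbound F _.
    (* Equicontinuity would give [kappa i < m], that is [i] outside [A m], for [F]-almost all [i] in
       [D], so [A m] would not be stationary. *)
    move=> /(ubp Y T Tcont)/(_ W W0)[U U0 FU]; have [m mU] := TW U U0.
    apply: (Astat m); apply: filterS (filterI FU FNP) => i [/= TU nPi] Ami.
    have A0i : A 0%N i by elim: (m) Ami => // n IH /Adecr.
    by have := mU i (conj A0i nPi) TU; rewrite ltnNge (hkappa i _ m).1.
  exists B; split=> // k; apply: sub_finite_set (Bfin k) => i [Bi nAk].
  by split=> //; rewrite ltnNge; apply/negP => /(hkappa i (BD i Bi) k).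
- have [Pstat|/contrapT FNP] := pselect (stationary F (I `&` P)).
    exists (I `&` P); split=> // k.
    by apply: sub_finite_set (finite_set0 _) => i [[_ Pi] []]; exact: Pi.
  pose D := (I `&` A 0%N) `\` P.
  have Dstat : stationary F D.
    move=> FND; apply: Istat.
    apply: filterS (filterI (filterI FND FNP) (AF 0%N)) => i [[nD nIP] A0i] Ii.
    by apply: nD; split=> // Pi; exact: nIP.
  have DA : D `<=` A 0%N by move=> i [[]].
  have DN i : D i -> ~ P i by case.
  have [kappa hkappa] := level_function Adecr DA DN.
  have [Y [T [Tcont Tbound [W W0 TW]]]] :=
    ladder_operators D kappa glbK hmetr hnorm.
  have [|B [Bstat BD Bfin]] := Tbound F _.
    (* The principle applied to the stationary set [D] would yield a stationary [J] disjoint from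
       some [A m], which is impossible as [A m] is in [F]. *)
    move=> /(subp Y T Tcont)/(_ D Dstat W W0)[U [J [U0 Jstat JD TU]]].
    have [m mU] := TW U U0.
    apply: Jstat; apply: filterS (AF m) => i Ami Ji; have Di := JD i Ji.
    by have := mU i Di (TU i Ji); rewrite ltnNge (hkappa i Di m).1.
  exists B; split=> // [|k]; first by move=> i /BD[[]].
  apply: sub_finite_set (Bfin k) => i [Bi nAk].
  by split=> //; rewrite ltnNge; apply/negP => /(hkappa i (BD i Bi) k).
Qed.
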